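(* Let $m\ge 1$ be an integer, let $\tau\in\mathbb R$ and $\eta\ge 0$, and let $\alpha,\beta:\mathbb R\to\mathbb R$ be locally integrable. Assume that $(-1)^m\beta(t)\ge 0$ for almost every $t\in[\tau,\tau+\eta]$. Let $U(t,\tau)$ be the solution operator on $X=C([-1,0])$ of the delay-differential equation $$\dot x(t)=-\alpha(t)x(t)-\beta(t)x(t-1),$$ and let $W(\tau+\eta,\tau)=U(\tau+\eta,\tau)^{\wedge m}$ be its $m$-fold exterior power on $X^{\wedge m}$. Then $W(\tau+\eta,\tau)$ is a positive operator with respect to the cone $K_m$, that is, $W(\tau+\eta,\tau)$ maps $K_m$ into itself.
   Context: $X=C([-1,0])$ is the Banach space of real continuous functions with the sup norm. For $t\ge\tau$ the solution operator $U(t,\tau)\in\mathcal L(X)$ is $U(t,\tau)\varphi=x_t$, where $x:[\tau-1,\infty)\to\mathbb R$ is the continuous function, locally absolutely continuous on $[\tau,\infty)$, satisfying the equation for a.e. $t\ge\tau$ with $x(\tau+\theta)=\varphi(\theta)$ for $\theta\in[-1,0]$, and $x_t(\theta)=x(t+\theta)$ for $\theta\in[-1,0]$. The $m$-fold tensor product (injective norm) $X^{\otimes m}$ is identified with $C([-1,0]^m)$ (sup norm), $\varphi_1\otimes\cdots\otimes\varphi_m$ being the function $\varphi_1(\theta_1)\cdots\varphi_m(\theta_m)$. For $A\in\mathcal L(X)$, $A^{\otimes m}$ is the unique bounded linear operator on $C([-1,0]^m)$ with $A^{\otimes m}(\varphi_1\otimes\cdots\otimes\varphi_m)=(A\varphi_1)\otimes\cdots\otimes(A\varphi_m)$.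 $X^{\wedge m}$ is the closed subspace of anti-symmetric functions: $\varphi(\theta_{\sigma(1)},\ldots,\theta_{\sigma(m)})=\operatorname{sgn}(\sigma)\varphi(\theta_1,\ldots,\theta_m)$ for all permutations $\sigma$ of $\{1,\dots,m\}$ and all $\theta\in[-1,0]^m$. It is invariant under $A^{\otimes m}$, and $A^{\wedge m}$ denotes the restriction of $A^{\otimes m}$ to $X^{\wedge m}$. $T_m=\{\theta\in[-1,0]^m : \theta_1\le\theta_2\le\cdots\le\theta_m\}$ and $K_m=\{\varphi\in X^{\wedge m} : \varphi(\theta)\ge 0 \text{ for every }\theta\in T_m\}$. *)

(* Defs.v *)
From HB Require Import structures.
From mathcomp Require Import all_boot all_order all_algebra perm.
From mathcomp Require Import all_classical all_reals all_analysis.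

Set Implicit Arguments.
Unset Strict Implicit.
Unset Printing Implicit Defensive.

Import Order.TTheory GRing.Theory Num.Theory.
Import numFieldNormedType.Exports.

Local Open Scope classical_set_scope.
Local Open Scope ring_scope.

(* C(K), for a compact space K. The proof that K is compact is a parameter of
   the type so that the sup norm can be installed as a canonical structure. *)
Definition Cspace (R : realType) (K : topologicalType)
  (cK : compact [set: K]) : Type := continuousType K R.

Section Cspace_normed.
Variables (R : realType) (K : topologicalType) (cK : compact [set: K]).
Local Notation C := (Cspace R cK).
Implicit Types (f g : C) (x : K).

HB.instance Definition _ := Choice.copy C (continuousType K R).

Definition Cval f : K -> R := Continuous.sort f.
#[warning="-uniform-inheritance"]
Local Coercion Cval : Cspace >-> Funclass.

Lemma Cval_continuous f : continuous f.
Proof. exact: (@cts_fun _ _ (f : continuousType K R)). Qed.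

Lemma CspaceP f g : (forall x, f x = g x) -> f = g.
Proof. by move=> fg; apply/(@continuousEP K R). Qed.

Definition Cmk (f : K -> R) (cf : continuous f) : C :=
  (mkcts cf : continuousType K R).

Lemma C0_subproof : continuous (fun _ : K => 0 : R).
Proof. by move=> x; exact: cvg_cst. Qed.

Lemma CN_subproof f : continuous (fun x => - f x).
Proof. by move=> x; apply: cvgN; exact: Cval_continuous. Qed.

Lemma CD_subproof f g : continuous (fun x => f x + g x).
Proof. by move=> x; apply: cvgD; exact: Cval_continuous. Qed.

Lemma CZ_subproof (a : R) f : continuous (fun x => a * f x).
Proof. by move=> x; apply: cvgMl_tmp; exact: Cval_continuous. Qed.

Definition C0 := Cmk C0_subproof.
Definition CN f := Cmk (@CN_subproof f).
Definition CD f g := Cmk (@CD_subproof f g).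
Definition CZ (a : R) f := Cmk (@CZ_subproof a f).

Lemma CDA : associative CD.
Proof. by move=> f g h; apply: CspaceP => x; exact: addrA. Qed.
Lemma CDC : commutative CD.
Proof. by move=> f g; apply: CspaceP => x; exact: addrC. Qed.
Lemma C0D : left_id C0 CD.
Proof. by move=> f; apply: CspaceP => x; exact: add0r. Qed.
Lemma CND : left_inverse C0 CN CD.
Proof. by move=> f; apply: CspaceP => x; exact: addNr. Qed.

HB.instance Definition _ := GRing.isZmodule.Build C CDA CDC C0D CND.

Lemma CZA (a b : R) f : CZ a (CZ b f) = CZ (a * b) f.
Proof. by apply: CspaceP => x; exact: mulrA. Qed.
Lemma C1Z : left_id 1 CZ.
Proof. by move=> f; apply: CspaceP => x; exact: mul1r. Qed.
Lemma CZDr : right_distributive CZ +%R.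
Proof. by move=> a f g; apply: CspaceP => x; exact: mulrDr. Qed.
Lemma CZDl f : {morph CZ^~ f : a b / a + b}.
Proof. by move=> a b; apply: CspaceP => x; exact: mulrDl. Qed.

HB.instance Definition _ :=
  GRing.Zmodule_isLmodule.Build R C CZA C1Z CZDr CZDl.

Definition Cnorm f : R := sup (range (fun x => `|f x|)).

Lemma Cnorm_has_ubound f : has_ubound (range (fun x => `|f x|)).
Proof.
have /compact_bounded[M [_ HM]] : compact ((fun x => f x) @` setT).
  apply: continuous_compact cK.
  exact/continuous_subspaceT/Cval_continuous.
exists (M + 1) => _ [x _ <-]; apply: (HM (M + 1)); first by rewrite ltrDl.
by exists x.
Qed.

Lemma le_Cnorm f x : `|f x| <= Cnorm f.
Proof. by apply: (ub_le_sup (Cnorm_has_ubound f)); exists x. Qed.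

Lemma Cnorm_ge0 f : 0 <= Cnorm f.
Proof.
have [E|/set0P[_ [x _ _]]] := eqVneq (range (fun x => `|f x|)) set0.
  by rewrite /Cnorm E sup0.
exact: le_trans (normr_ge0 (f x)) (le_Cnorm f x).
Qed.

Lemma Cnorm_le f (M : R) : 0 <= M -> (forall x, `|f x| <= M) -> Cnorm f <= M.
Proof.
move=> M0 fM; have [E|/set0P ne] := eqVneq (range (fun x => `|f x|)) set0.
  by rewrite /Cnorm E sup0.
by apply: ge_sup => // _ [x _ <-].
Qed.

Lemma Cnorm_triangle f g : Cnorm (f + g) <= Cnorm f + Cnorm g.
Proof.
apply: Cnorm_le => [|x]; first by rewrite addr_ge0// Cnorm_ge0.
by rewrite (le_trans (ler_normD _ _))// lerD// le_Cnorm.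
Qed.

Lemma Cnorm_homogeneous (a : R) f : Cnorm (a *: f) = `|a| * Cnorm f.
Proof.
have le b h : Cnorm (b *: h) <= `|b| * Cnorm h.
  apply: Cnorm_le => [|x]; first by rewrite mulr_ge0// Cnorm_ge0.
  by rewrite [leLHS]normrM ler_wpM2l// le_Cnorm.
apply/eqP; rewrite eq_le le/=; have [->|a0] := eqVneq a 0.
  by rewrite normr0 mul0r Cnorm_ge0.
have := le a^-1 (a *: f); rewrite scalerA mulVf// scale1r normfV.
by rewrite mulrC ler_pdivlMr ?normr_gt0// mulrC.
Qed.

Lemma Cnorm_eq0 f : Cnorm f = 0 -> f = 0.
Proof.
move=> f0; apply: CspaceP => x; apply/normr0_eq0/eqP.
by rewrite -normr_le0 normr_id -f0 le_Cnorm.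
Qed.

HB.instance Definition _ :=
  Lmodule_isNormed.Build R C Cnorm_triangle Cnorm_homogeneous Cnorm_eq0.

End Cspace_normed.

Arguments Cval_continuous {R K cK} f.
Arguments Cmk {R K cK f} cf.
#[warning="-uniform-inheritance"]
Coercion Cval : Cspace >-> Funclass.

(* The interval [-1,0] with its subspace topology, and the cube [-1,0]^m with
   the product topology. *)
Definition Icc (R : realType) : Type := set_type `[(-1 : R), 0].
HB.instance Definition _ (R : realType) :=
  PseudoMetric.copy (Icc R) (set_type `[(-1 : R), 0]).

Definition cube (R : realType) (m : nat) : Type := {ptws 'I_m -> Icc R}.
HB.instance Definition _ (R : realType) (m : nat) :=
  Uniform.copy (cube R m) {ptws 'I_m -> Icc R}.

Lemma compact_Icc (R : realType) : compact [set: Icc R].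
Proof.
pose p (x : R) := Num.max (-1) (Num.min x 0).
have pI x : p x \in `[(-1 : R), 0]%classic.
  rewrite inE/= in_itv/= /p le_max lexx/= ge_max lerN10/=.
  by rewrite ge_min lexx orbT.
pose q (x : R) : Icc R := exist _ (p x) (pI x).
have -> : [set: Icc R] = q @` `[(-1 : R), 0].
  apply/seteqP; split => // -[x xI] _.
  have /andP[x1 x0] : -1 <= x <= 0 by have := set_mem xI; rewrite /= in_itv.
  exists x; first by rewrite /= in_itv/= x1 x0.
  by apply: val_inj; rewrite /= /p min_l// max_r.
apply: continuous_compact; last exact: segment_compact.
apply/continuous_subspaceT/continuous_comp_initial => x.
apply: (@continuous_max R R (fun=> -1) (fun x => Num.min x 0)).
  exact: cvg_cst.
apply: (@continuous_min R R id (fun=> 0)); first exact: cvg_id.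
exact: cvg_cst.
Qed.

Lemma compact_cube (R : realType) (m : nat) : compact [set: cube R m].
Proof.
have := @tychonoff 'I_m (fun=> Icc R) (fun=> setT) (fun=> @compact_Icc R).
congr compact; exact/seteqP.
Qed.

(* X^{(x) m} is identified with C([-1,0]^m); these are notations rather than
   definitions so that the coercion Cval is found. *)
Notation Xspace R := (Cspace R (@compact_Icc R)).
Notation Xtensor R m := (Cspace R (@compact_cube R m)).

Lemma tensor_subproof (R : realType) (m : nat) (phi : 'I_m -> Xspace R) :
  continuous (fun theta : cube R m => \prod_(i < m) phi i (theta i)).
Proof.
apply: continuous_big => [|i _]; first exact: mul_continuous.
move=> theta; apply: (@continuous_comp _ _ _ (fun t : cube R m => t i)).
  exact: (@proj_continuous 'I_m (fun=> Icc R) i).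
exact: (Cval_continuous (phi i)).
Qed.

Definition tensor (R : realType) (m : nat) (phi : 'I_m -> Xspace R) :
  Xtensor R m := Cmk (@tensor_subproof R m phi).

(* T = A^{(x) m}, determined by A because tensors span a dense subspace; for a
   linear map between normed spaces, continuity is boundedness. *)
Definition is_tensor_power (R : realType) (m : nat)
    (A : Xspace R -> Xspace R) (T : {linear Xtensor R m -> Xtensor R m}) :=
  continuous T /\ forall phi : 'I_m -> Xspace R, T (tensor phi) = tensor (A \o phi).

Definition Xwedge (R : realType) (m : nat) : set (Xtensor R m) :=
  [set phi | forall (s : 'S_m) (theta : cube R m),
     phi (theta \o s) = (-1) ^+ odd_perm s * phi theta].
Arguments Xwedge R m : clear implicits.

(* W = A^{/\ m}, the restriction of A^{(x) m} to X^{/\ m} *)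
Definition is_exterior_power (R : realType) (m : nat)
    (A : Xspace R -> Xspace R) (W : Xwedge R m -> Xwedge R m) :=
  exists2 T : {linear Xtensor R m -> Xtensor R m}, is_tensor_power A T &
    forall phi : Xwedge R m, \val (W phi) = T (\val phi).

Definition simplex (R : realType) (m : nat) : set (cube R m) :=
  [set theta | forall i j : 'I_m, (i <= j)%N -> \val (theta i) <= \val (theta j)].
Arguments simplex R m : clear implicits.

Definition Kcone (R : realType) (m : nat) : set (Xwedge R m) :=
  [set phi | forall theta : cube R m,
     simplex R m theta -> 0 <= (\val phi : Xtensor R m) theta].
Arguments Kcone R m : clear implicits.

Definition abs_continuous (R : realType) (a b : R) (f : R -> R) :=
  forall e : R, 0 < e -> exists2 d : R, 0 < d &
    forall (n : nat) (u v : 'I_n -> R),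
      (forall i, [/\ a <= u i, u i <= v i & v i <= b]) ->
      trivIset [set: 'I_n] (fun i => `]u i, v i[%classic) ->
      \sum_(i < n) (v i - u i) < d -> \sum_(i < n) `|f (v i) - f (u i)| < e.

(* The library's [locally_integrable] asks for Borel measurability; allowing for
   a modification on a null set covers all Lebesgue measurable functions. *)
Definition L1loc (R : realType) (f : R -> R) :=
  exists2 g : R -> R, locally_integrable [set: R] g &
    {ae lebesgue_measure, forall t, f t = g t}.

(* The solution x of x'(t) = - alpha(t) x(t) - beta(t) x(t-1), t >= tau, with
   initial function phi; only the values of x on [tau-1, +oo[ are meaningful. *)
Definition is_solution (R : realType) (alpha beta : R -> R) (tau : R)
    (phi : Xspace R) (x : R -> R) :=
  [/\ {within `[tau - 1, +oo[, continuous x},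
      forall b, tau <= b -> abs_continuous tau b x,
      {ae lebesgue_measure, forall t, tau <= t ->
        is_derive t (1 : R) x (- alpha t * x t - beta t * x (t - 1))} &
      forall theta : Icc R, x (tau + \val theta) = phi theta].

(* U = U(t,tau), i.e. U phi = x_t for the solution x with x_tau = phi. Solutions
   are unique, so this determines U. *)
Definition is_solution_operator (R : realType) (alpha beta : R -> R)
    (t tau : R) (U : Xspace R -> Xspace R) :=
  forall phi : Xspace R, exists2 x : R -> R, is_solution alpha beta tau phi x &
    forall theta : Icc R, U phi theta = x (t + \val theta).

(* Main.v *)
Require Import Defs.
From mathcomp Require Import all_boot all_order all_algebra.
From mathcomp Require Import all_classical all_reals all_analysis.
From mathcomp Require Import perm measurable_realfun ring lra zify.

Set Implicit Arguments.
Unset Strict Implicit.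
Unset Printing Implicit Defensive.

Import Order.TTheory GRing.Theory Num.Theory.
Import numFieldNormedType.Exports.

Local Open Scope classical_set_scope.
Local Open Scope ring_scope.

(* Approximate an antisymmetric Phi that is nonnegative on the simplex by its
   multilinear interpolants on finer and finer grids of the cube. The m-th
   tensor power of U maps such an interpolant to
     F(t) = sum_J Phi(p_J) prod_l x_(J l)(t_l),   t_l = tau + eta + theta_l,
   where x_j solves the equation with the j-th hat function as initial value.
   F is antisymmetric and, in each variable, a solution of the equation.

   For sorted t in [tau - 1, tau], F(t) >= 0: F is affine in each variable on
   each grid cell, vanishes when two variables coincide, and equals Phi at the
   grid points. Positivity then propagates in time: as a function of the largest
   variable r, z = F(t_1, .., t_(m-1), r) satisfies z' = - alpha z - beta z(r-1)
   and moving r - 1 to the first place gives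
     - beta(r) z(r-1) = (-1)^m beta(r) F(r-1, t_1, .., t_(m-1)) >= 0,
   whose arguments are again sorted and closer to [tau - 1, tau], while z >= 0
   at r = max(tau, t_(m-1)). *)

(** * Absolutely continuous functions *)

Section ac_nondecreasing.
Variable R : realType.
Implicit Types (a b : R) (f : R -> R).
Local Notation mu := (@lebesgue_measure R).

(** The straddle estimate: [c] and [d] lie on opposite sides of [x], so the one-sided bounds coming
    from the difference quotient add up, with one [r] for all such pairs. *)
Lemma near_derive_ge0_ge f (x e : R) : 0 < e ->
  (exists2 d, is_derive x 1 f d & 0 <= d) ->
  exists2 r, 0 < r & forall c d, x - r < c -> c <= x -> x <= d -> d < x + r ->
    f c - f d <= e * (d - c).
Proof.
move=> e0 [D [fD Dval] D0].
have : h^-1 *: ((f \o shift x) (h *: 1) - f x) @[h --> 0^'] --> D.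
  by rewrite -Dval; exact: fD.
move/cvgrPdist_lt => /(_ e e0); rewrite near_withinE.
move=> /nbhs_ballP[r/= r0 rP]; exists r => // c d xrc cx xd dxr.
have key y : `|y - x| < r -> y != x -> (f y - f x) / (y - x) > - e.
  move=> yr yx; have := rP (y - x); rewrite /ball/= sub0r normrN => /(_ yr).
  rewrite subr_eq0 => /(_ yx); rewrite /GRing.scale/= mulr1 subrK ltr_norml.
  by move=> /andP[_]; rewrite mulrC; lra.
have fc : f c - f x <= e * (x - c).
  have [->|cx'] := eqVneq c x; first by rewrite !subrr mulr0.
  have xc : 0 < x - c by rewrite subr_gt0 lt_neqAle cx'.
  have : `|c - x| < r by rewrite distrC gtr0_norm//; lra.
  move=> /key /(_ cx'); rewrite -[c - x]opprB invrN mulrN -mulNr.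
  by rewrite ltr_pdivlMr//; lra.
have fd : f x - f d <= e * (d - x).
  have [->|dx'] := eqVneq d x; first by rewrite !subrr mulr0.
  have xc : 0 < d - x by rewrite subr_gt0 lt_neqAle eq_sym dx'.
  have : `|d - x| < r by rewrite gtr0_norm//; lra.
  move=> /key /(_ dx'); rewrite ltr_pdivlMr//; lra.
lra.
Qed.

Lemma lebesgue_measure_bigsetU_itvoo n (u v : 'I_n -> R) :
  (forall i, u i <= v i) ->
  trivIset [set: 'I_n] (fun i => `]u i, v i[%classic) ->
  mu (\big[setU/set0]_(i < n) `]u i, v i[%classic) =
    (\sum_(i < n) (v i - u i))%:E.
Proof.
move=> uv tuv; rewrite measure_semi_additive_ord//; last first.
  by apply: bigsetU_measurable => i _; exact: measurable_itv.
rewrite -sumEFin; apply: eq_bigr => i _.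
rewrite [LHS]lebesgue_measure_itv/= lte_fin; case: ltP => // vu.
by rewrite (@le_anti _ _ (u i) (v i)) ?uv// subrr.
Qed.

(* U is an open set of small measure covering the exceptional points, and
   [G c] says that f decreases by at most e (c - a) on [a, c], not counting its
   variation on finitely many disjoint intervals in U; a supremum argument
   gives [G b]. *)
Lemma ac_derive_ge0_le a b f : a <= b -> abs_continuous a b f ->
  {ae mu, forall t, a < t < b -> exists2 d, is_derive t 1 f d & 0 <= d} ->
  f a <= f b.
Proof.
move=> ab acf [N0 [mN0 N00 N0P]].
(* The derivative is given only on the open interval, so the endpoints are put into the null set: a
   point of the interval outside [U] is then interior and has a nonnegative derivative. *)
pose N := N0 `|` [set a; b].
have mN : measurable N by apply: measurableU => //; exact: measurableU.
have Nnull : mu N = 0%E.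
  apply: null_set_setU => //; first exact: measurableU.
  by apply: null_set_setU => //; exact: lebesgue_measure_set1.
apply/ler_addgt0Pl => e0 e0_gt0.
(* The slope error [e * (b - a)] and the variation [e] over [U] add up to [e0]. *)
pose e := e0 / (b - a + 1).
have e_gt0 : 0 < e by rewrite divr_gt0//; lra.
have [d d0 acd] := acf e e_gt0.
have muN_fin : (mu N < +oo)%E by rewrite Nnull ltry.
have [U [oU NU Ud]] := lebesgue_regularity_outer mN muN_fin d0.
have muU : (mu U < d%:E)%E.
  have -> : mu U = mu ((U `\` N) `|` N) by rewrite setUC setDUK.
  apply: le_lt_trans Ud; rewrite -[leRHS]adde0 -Nnull.
  by apply: measureU2 => //; apply: measurableD => //; exact: open_measurable.
pose G c := [/\ a <= c, c <= b & exists n (u v : 'I_n -> R),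
  [/\ forall i, [/\ a <= u i, u i <= v i & v i <= c],
      forall i, `]u i, v i[ `<=` U,
      trivIset [set: 'I_n] (fun i => `]u i, v i[%classic) &
      f a - f c <= e * (c - a) + \sum_(i < n) `|f (v i) - f (u i)| ]].
have Ga : G a.
  split => //; exists 0, (fun=> a), (fun=> a); split.
  - by case.
  - by case.
  - by move=> [].
  - by rewrite big_ord0 !subrr mulr0 addr0.
(* Crossing [x]: inside [U] the interval from [c] to [d'] joins the family and pays by its
   variation; outside [U] the straddle estimate pays. *)
have Gstep x : a <= x <= b -> exists2 r, 0 < r & forall c d', x - r < c ->
    c <= x -> x <= d' -> d' < x + r -> d' <= b -> G c -> G d'.
  move=> /andP[ax xb]; have [Ux|nUx] := pselect (U x).
    have [r/= r0 rU] : nbhs_ball x U.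
      by apply/nbhs_ballP; apply: open_nbhs_nbhs; split.
    exists r => // c d' xrc cx xd dxr db [ac cb [n [u [v [H1 H2 H3 H4]]]]].
    (* The new interval gets index [ord0]; it is disjoint from the old ones because these end by
       [c]. *)
    pose ext (g : 'I_n -> R) y i := oapp g y (unlift ord0 i).
    split; [lra|lra|exists n.+1, (ext u c), (ext v d'); split].
    - move=> i; rewrite /ext; case: unliftP => [j _|_] /=; last by split; lra.
      by have [? ? ?] := H1 j; split => //; lra.
    - move=> i; rewrite /ext; case: unliftP => [j _|_] /=; first exact: H2.
      move=> y; rewrite /= in_itv/= => /andP[cy yd]; apply: rU.
      by rewrite /ball/= ltr_norml; lra.
    - apply/trivIsetP => i j _ _; rewrite /ext.
      case: unliftP => [i'|] ->; case: unliftP => [j'|] ->//=.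
      + rewrite (inj_eq lift_inj) => ij.
        by move/trivIsetP : H3; apply.
      + move=> _; rewrite -subset0 => y; rewrite /= !in_itv/= => -[].
        have [_ _ ?] := H1 i'; lra.
      + move=> _; rewrite -subset0 => y; rewrite /= !in_itv/= => -[].
        have [_ _ ?] := H1 j'; lra.
    - rewrite big_ord_recl /ext unlift_none/=.
      under eq_bigr do rewrite liftK/=.
      have h1 := ler_norm (f c - f d').
      rewrite distrC in h1.
      have h2 : 0 <= e * (d' - c) by rewrite mulr_ge0//; lra.
      lra.
  have xab : a < x < b.
    rewrite !lt_neqAle ax xb !andbT; apply/andP.
    by split; apply/eqP => xE; apply/nUx/NU; right; rewrite xE /=; tauto.
  have [r r0 rP] : exists2 r, 0 < r & forall c d', x - r < c -> c <= x ->
      x <= d' -> d' < x + r -> f c - f d' <= e * (d' - c).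
    apply: (@near_derive_ge0_ge f) => //.
    by apply: contrapT => H; apply: nUx; apply: NU; left; apply: N0P => /(_ xab).
  exists r => // c d' xrc cx xd dxr db [ac cb [n [u [v [H1 H2 H3 H4]]]]].
  split; [lra|lra|exists n, u, v; split => //].
    by move=> i; have [? ? ?] := H1 i; split => //; lra.
  have := rP c d' xrc cx xd dxr; lra.
have Gb : G b.
  have supG : has_sup G.
    by split; [exists a|exists b => c []].
  have sa : a <= sup G <= b.
    apply/andP; split; first exact: (ub_le_sup supG.2).
    by apply: ge_sup; [exists a|move=> c []].
  have [r r0 rP] := Gstep _ sa.
  have [c Gc src] := sup_adherent r0 supG.
  have cs : c <= sup G by exact: (ub_le_sup supG.2).
  (* A step past the supremum, capped at [b], stays in [G]; hence the supremum is [b]. *)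
  have Gm : G (Num.min b (sup G + r / 2)).
    apply: (rP c) => //.
    - by rewrite le_min; lra.
    - by rewrite gt_min; lra.
    - by rewrite ge_min lexx.
  have minG : Num.min b (sup G + r / 2) <= sup G by exact: (ub_le_sup supG.2).
  have bs : sup G = b.
    by apply/le_anti; rewrite (andP sa).2; move: minG; rewrite ge_min; lra.
  by apply: (rP c) Gc; lra.
have [_ _ [n [u [v [H1 H2 H3 H4]]]]] := Gb.
have uv i : u i <= v i by case: (H1 i).
have sum_lt : \sum_(i < n) (v i - u i) < d.
  rewrite -lte_fin -lebesgue_measure_bigsetU_itvoo//; apply: le_lt_trans muU.
  apply: le_measure; rewrite ?inE.
  - by apply: bigsetU_measurable => i _; exact: measurable_itv.
  - exact: open_measurable.
  - by apply: (big_ind (fun A => A `<=` U)) => // A B AU BU x [/AU|/BU].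
have := acd n u v H1 H3 sum_lt.
have -> : e0 = e * (b - a) + e by rewrite /e; field; lra.
lra.
Qed.

End ac_nondecreasing.

(** * Closure properties of absolute continuity *)

Section ac_closure.
Variables (R : realType) (a b : R).
Implicit Types f g h : R -> R.

Lemma abs_continuous_sub c d f : a <= c -> d <= b ->
  abs_continuous a b f -> abs_continuous c d f.
Proof.
move=> ac db acf e /acf[r r0 rP]; exists r => // n u v uv; apply: rP => i.
by have [cu ? vd] := uv i; split=> //; [exact: le_trans cu|exact: le_trans db].
Qed.

(** The common source of the stability under sums, products and [expR]; a bound by a single function
    takes [h] constant. *)
Lemma abs_continuous_dominated (C : R) f g h :
  abs_continuous a b g -> abs_continuous a b h ->
  (forall u v, a <= u -> u <= v -> v <= b ->
    `|f v - f u| <= C * (`|g v - g u| + `|h v - h u|)) ->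
  abs_continuous a b f.
Proof.
(* The sign of [C] is unknown, and the tolerance is to be divided by it. *)
move=> acg ach fgh e e0; pose C' := Num.max C 1.
have C'0 : 0 < C' by rewrite lt_max ltr01 orbT.
have e'0 : 0 < e / (C' * 2) by rewrite divr_gt0// mulr_gt0.
have [r r0 rP] := acg _ e'0; have [s s0 sP] := ach _ e'0.
exists (Num.min r s) => [|n u v uv tuv]; first by rewrite lt_min r0.
rewrite lt_min => /andP[/(rP _ _ _ uv tuv) gr /(sP _ _ _ uv tuv) hs].
apply: le_lt_trans (_ : C' * (\sum_(i < n) `|g (v i) - g (u i)| +
    \sum_(i < n) `|h (v i) - h (u i)|) < e).
  rewrite -big_split mulr_sumr; apply: ler_sum => i _ /=.
  have [? ? ?] := uv i; apply: le_trans (fgh _ _ _ _ _) _ => //.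
  by rewrite ler_wpM2r ?addr_ge0// le_max lexx.
have -> : e = C' * (e / (C' * 2) + e / (C' * 2)).
  by field; rewrite gt_eqF.
by rewrite ltr_pM2l// ltrD.
Qed.

Lemma abs_continuous_cst (k : R) : abs_continuous a b (fun=> k).
Proof.
move=> e e0; exists 1 => // n u v _ _ _; rewrite big1// => i _.
by rewrite subrr normr0.
Qed.

Lemma abs_continuous_sum (I : finType) (k : I -> R) (F : I -> R -> R) :
  (forall i, abs_continuous a b (F i)) ->
  abs_continuous a b (fun t => \sum_i k i * F i t).
Proof.
move=> acF; rewrite /index_enum; elim: (Finite.enum I) => [|i s IH].
  by under eq_fun do rewrite big_nil; exact: abs_continuous_cst.
under eq_fun do rewrite big_cons.
apply: (abs_continuous_dominated (C := Num.max `|k i| 1)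
  (f := fun t => k i * F i t + \sum_(j <- s) k j * F j t) (acF i) IH).
move=> u v _ _ _; rewrite opprD addrACA -mulrBr (le_trans (ler_normD _ _))//.
rewrite [leRHS]mulrDr; apply: lerD.
  by rewrite normrM ler_wpM2r// le_max lexx.
by rewrite ler_peMl// le_max lexx orbT.
Qed.

(** With tolerance 1, steps shorter than some [d] change [f] by less than 1, and boundedly many
    steps of length [d / 2] lead from [a] to any point. *)
Lemma abs_continuous_bounded f : abs_continuous a b f ->
  exists2 M, 0 < M & forall x, a <= x -> x <= b -> `|f x| <= M.
Proof.
move=> /(_ 1 ltr01)[d d0 dP].
have step u v : a <= u -> u <= v -> v <= b -> v - u < d -> `|f v - f u| < 1.
  move=> au uv vb vud; have := dP 1 (fun=> u) (fun=> v).
  rewrite !big_ord1; apply => //.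
  by apply/trivIsetP => i j _ _; rewrite !ord1 eqxx.
have key k x : a <= x -> x <= b -> x - a <= k%:R * (d / 2) ->
    `|f x - f a| <= k%:R.
  elim: k x => [|k IH] x ax xb.
    by rewrite mul0r => xa; have -> : x = a; [lra|rewrite subrr normr0].
  rewrite -[k.+1%:R]natr1 => xk; pose y := Num.max a (x - d / 2).
  have ay : a <= y by rewrite le_max lexx.
  have yx : y <= x by rewrite ge_max; lra.
  have yk : y - a <= k%:R * (d / 2).
    have kd0 : 0 <= k%:R * (d / 2) by rewrite mulr_ge0//; lra.
    by rewrite lerBlDr ge_max; apply/andP; split; lra.
  have xyd : x - y < d by rewrite ltrBlDl -ltrBlDr lt_max; lra.
  have h1 := IH y ay (le_trans yx xb) yk.
  have h2 := step y x ay yx xb xyd.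
  have -> : f x - f a = (f x - f y) + (f y - f a) by ring.
  apply: le_trans (ler_normD _ _) _; lra.
pose k := (Num.truncn ((b - a) / (d / 2))).+1.
exists (`|f a| + k%:R) => [|x ax xb].
  by rewrite ltr_wpDl// ltr0n.
have -> : f x = f a + (f x - f a) by ring.
rewrite (le_trans (ler_normD _ _))// lerD2l; apply: key => //.
have : (b - a) / (d / 2) < k%:R by exact: truncnS_gt.
by rewrite ltr_pdivrMr; lra.
Qed.

Lemma abs_continuousM f g : abs_continuous a b f -> abs_continuous a b g ->
  abs_continuous a b (f * g).
Proof.
move=> acf acg; have [M M0 Mf] := abs_continuous_bounded acf.
have [L L0 Lg] := abs_continuous_bounded acg.
apply: (abs_continuous_dominated (C := M + L) (f := f * g) acf acg) => u v au uv vb.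
have -> : (f * g) v - (f * g) u = (f v - f u) * g v + f u * (g v - g u).
  by rewrite !fctE; ring.
rewrite (le_trans (ler_normD _ _))// !normrM.
have h1 := ler_wpM2l (normr_ge0 (f v - f u)) (Lg v (le_trans au uv) vb).
have h2 := ler_wpM2r (normr_ge0 (g v - g u)) (Mf u au (le_trans uv vb)).
have h3 := mulr_ge0 (normr_ge0 (f v - f u)) (ltW M0).
have h4 := mulr_ge0 (normr_ge0 (g v - g u)) (ltW L0).
lra.
Qed.

(** Since [f] is bounded by some [M], it suffices that [expR] is Lipschitz with constant [expR M]
    below [M], which follows from [1 + x <= expR x]. *)
Lemma abs_continuous_expR f : abs_continuous a b f ->
  abs_continuous a b (expR \o f).
Proof.
move=> acf; have [M M0 Mf] := abs_continuous_bounded acf.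
have expRB (x y : R) : x <= M -> y <= x -> expR x - expR y <= expR M * (x - y).
  move=> xM yx; have -> : expR x - expR y = expR x * (1 - expR (y - x)).
    by rewrite mulrBr mulr1 -expRD [x + _]addrC subrK.
  have := expR_ge1Dx (y - x) => h.
  apply: (@le_trans _ _ (expR x * (x - y))).
    by rewrite ler_wpM2l ?expR_ge0//; lra.
  by rewrite ler_wpM2r ?ler_expR//; lra.
have le_M x : a <= x -> x <= b -> f x <= M.
  by move=> ax xb; exact: le_trans (ler_norm _) (Mf x ax xb).
apply: (abs_continuous_dominated (C := expR M) (f := expR \o f) acf
  (abs_continuous_cst 0)).
move=> u v au uv vb; rewrite subrr normr0 addr0 /=.
have [fuv|/ltW fvu] := leP (f u) (f v).
  by rewrite !ger0_norm ?subr_ge0 ?ler_expR// expRB ?le_M//; lra.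
rewrite distrC (distrC (f v)) !ger0_norm ?subr_ge0 ?ler_expR// expRB ?le_M//; lra.
Qed.

End ac_closure.

(** * Primitives of locally integrable functions *)

Section primitive.
Variables (R : realType) (g : R -> R).
Hypothesis gL : locally_integrable [set: R] g.
Local Notation mu := (@lebesgue_measure R).

Lemma locally_integrable_itv (x y : R) : mu.-integrable `[x, y] (EFin \o g).
Proof.
have [mg _ gfin] := gL; apply/integrableP; split.
  by apply/measurable_EFinP; apply: measurable_funS mg.
by apply: gfin => //; exact: segment_compact.
Qed.

Lemma primitive_ac (a b : R) :
  abs_continuous a b (fun t => \int[mu]_(x in `[a, t]) g x)%R.
Proof.
move=> e e0.
(* Cutting [g] off outside [[a, b]] makes it integrable on the whole line, so its integral over sets
   of small measure is uniformly small. *)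
have intg : mu.-integrable setT (EFin \o g \_ `[a, b]).
  rewrite -restrict_EFin; apply/integrable_restrict => //=.
  by rewrite setTI; exact: locally_integrable_itv.
have [d [d0 dP]] := integral_normr_continuous intg e0.
exists d => // n u v uv tuv sum_d.
have mitv i : measurable `]u i, v i[%classic by [].
pose D := \big[setU/set0]_(i < n) `]u i, v i[%classic.
have mD : measurable D by exact: bigsetU_measurable.
have muD : (mu D < d%:E)%E.
  by rewrite lebesgue_measure_bigsetU_itvoo ?lte_fin// => i; case: (uv i).
apply: le_lt_trans (dP D mD muD).
have intD (A : set R) : measurable A ->
    mu.-integrable A (EFin \o (fun x => `|(g \_ `[a, b]) x|)).
  by move=> mA; apply: (@integrableS _ _ _ _ setT) => //; exact: integrable_norm.
rewrite -lee_fin /Rintegral fineK; last exact: integrable_fin_num (intD D mD).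
have intE := @ge0_integral_bigsetU _ _ R mu _ (fun i => `]u i, v i[%classic)
  (fun x => `|(g \_ `[a, b]) x|%:E) (index_enum 'I_n) mitv (index_enum_uniq _).
rewrite /D intE//; last 2 first.
- by apply: sub_trivIset tuv.
- by have := intD D mD => /integrableP[].
rewrite -sumEFin; apply: lee_sum => i _.
have [aui uvi vib] := uv i.
have intuv : mu.-integrable `]u i, v i[ (EFin \o g).
  apply: integrableS (locally_integrable_itv (u i) (v i)) => //.
  exact: subset_itv_oo_cc.
have -> : \int[mu]_(x in `[a, v i]) g x - \int[mu]_(x in `[a, u i]) g x =
    \int[mu]_(x in `]u i, v i[) g x.
  rewrite Rintegral_itvB ?bnd_simp//; last exact: locally_integrable_itv.
  by rewrite Rintegral_itv_bndo_bndc.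
rewrite -[leRHS]fineK; last exact: integrable_fin_num (intD _ (mitv i)).
rewrite lee_fin (le_trans (le_normr_Rintegral _ _))//.
rewrite le_eqVlt; apply/orP; left; apply/eqP; apply: eq_Rintegral => x.
rewrite inE/= in_itv/= patchE => /andP[ux xv]; rewrite mem_set//= in_itv/=.
lra.
Qed.

Lemma primitive_derive (a : R) :
  {ae mu, forall t, a < t ->
    is_derive t (1 : R) (fun t => \int[mu]_(x in `[a, t]) g x)%R (g t)}.
Proof.
have := @FTC1 R g (BLeft a) (fun y => locally_integrable_itv a y) gL.
apply: filterS; first exact: (ae_filter_ringOfSetsType mu).
move=> t /= H at_; have [|dF FE] := H _; first by rewrite ?bnd_simp ?ltW.
by split => //; rewrite -derive1E.
Qed.

End primitive.

(* The integrating factor exp (\int alpha) reduces this to monotonicity. *)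
Lemma linear_ode_ge0 (R : realType) (alpha p z : R -> R) (c d : R) :
  c <= d -> L1loc alpha -> abs_continuous c d z ->
  {ae lebesgue_measure, forall t, c <= t <= d ->
    is_derive t (1 : R) z (- alpha t * z t + p t)} ->
  {ae lebesgue_measure, forall t, c <= t <= d -> 0 <= p t} ->
  0 <= z c -> 0 <= z d.
Proof.
move=> cd [g gL alphag] acz dz p0 zc.
pose A t := (\int[@lebesgue_measure R]_(x in `[c - 1, t]) g x)%R.
pose G := (expR \o A) * z.
have acG : abs_continuous c d G.
  apply: abs_continuousM => //; apply: abs_continuous_expR.
  by apply: abs_continuous_sub (primitive_ac gL (c - 1) d) => //; lra.
have GE t : G t = expR (A t) * z t by [].
suff : G c <= G d.
  rewrite !GE => h; rewrite -(pmulr_rge0 _ (expR_gt0 (A d))).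
  by apply: le_trans h; rewrite mulr_ge0// expR_ge0.
apply: ac_derive_ge0_le => //.
have aeF := ae_filter_ringOfSetsType (@lebesgue_measure R).
have := @filterI _ _ aeF _ _ alphag (primitive_derive gL (c - 1)); move: dz p0.
apply: filterS3 => t dz p0 [alphat dA] /andP[ct td].
have ctd : c <= t <= d by rewrite !ltW.
have {}dz := dz ctd; have {}p0 := p0 ctd.
have {}dA : is_derive t (1 : R) A (g t) by apply: dA; lra.
have dE := is_derive1_comp (is_derive_expR (A t)) dA.
have dG := is_deriveM dE dz.
(* The product rule cancels the [alpha] terms, as [alpha t] equals its representative [g t]; only
   the forcing term times a positive factor remains. *)
exists (expR (A t) * p t); last by rewrite mulr_ge0 ?expR_ge0.
apply: is_derive_eq dG _.
by rewrite /GRing.scale/= alphat; ring.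
Qed.

(** * Antisymmetric and multi-affine functions *)

Section antisymmetric.
Variables (R : realType) (n : nat).
Implicit Types (F : ('I_n -> R) -> R) (t : 'I_n -> R) (s : 'S_n).

Definition antisymmetric_fun F :=
  forall s t, F (t \o s) = (-1) ^+ odd_perm s * F t.

(** Swapping [i] and [j] fixes [t] but flips the sign. These zeros on the diagonals serve as
    boundary values both on the grid and in time. *)
Lemma antisymmetric_fun_eq0 F t i j :
  antisymmetric_fun F -> i != j -> t i = t j -> F t = 0.
Proof.
move=> asF ij tij; have := asF (tperm i j) t.
have -> : t \o tperm i j = t.
  by apply/funext => l /=; case: tpermP => [->|->|].
rewrite odd_tperm ij expr1 mulN1r => h; lra.
Qed.

Definition upd t (k : 'I_n) (r : R) : 'I_n -> R :=
  fun l => if l == k then r else t l.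

Lemma upd_id t k : upd t k (t k) = t.
Proof. by apply/funext => l; rewrite /upd; case: eqP => [->|]. Qed.

End antisymmetric.

(** * Sums of products of one-variable functions *)

Section tensor_sum.
Variables (R : realType) (n : nat) (I : finType).
Variables (Phi : {ffun 'I_n -> I} -> R) (x : I -> R -> R).

(** With hat functions for [x] this is the interpolant; with the solutions starting from them it is
    the image of the interpolant. *)
Definition tensor_sum (t : 'I_n -> R) : R :=
  \sum_(J : {ffun 'I_n -> I}) Phi J * \prod_l x (J l) (t l).

Lemma tensor_sum_antisymmetric :
  (forall (s : 'S_n) (J : {ffun 'I_n -> I}),
    Phi [ffun l => J (s l)] = (-1) ^+ odd_perm s * Phi J) ->
  antisymmetric_fun tensor_sum.
Proof.
move=> asPhi s t; rewrite /tensor_sum mulr_sumr.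
pose h (J : {ffun 'I_n -> I}) : {ffun 'I_n -> I} := [ffun l => J (s l)].
pose h' (J : {ffun 'I_n -> I}) : {ffun 'I_n -> I} := [ffun l => J ((s^-1)%g l)].
have hK : cancel h' h by move=> J; apply/ffunP => l; rewrite !ffunE permK.
have hK' : cancel h h' by move=> J; apply/ffunP => l; rewrite !ffunE permKV.
rewrite (reindex h); last by exists h' => J _; [exact: hK'|exact: hK].
apply: eq_bigr => J _; rewrite asPhi -mulrA; congr (_ * (_ * _)).
rewrite [RHS](reindex_inj (@perm_inj _ s)).
by apply: eq_bigr => l _; rewrite ffunE.
Qed.

(** Freezing all variables but one leaves a linear combination of the [x j], so absolute continuity,
    the linear equation and affinity on cells carry over from the [x j]. *)
Lemma tensor_sum_upd t k : exists c : I -> R,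
  forall r, tensor_sum (upd t k r) = \sum_j c j * x j r.
Proof.
exists (fun j => \sum_(J : {ffun 'I_n -> I} | J k == j)
  Phi J * \prod_(l | l != k) x (J l) (t l)) => r.
rewrite /tensor_sum (partition_big (fun J : {ffun 'I_n -> I} => J k) xpredT)//=.
apply: eq_bigr => j _; rewrite mulr_suml; apply: eq_bigr => J /eqP <-.
rewrite (bigD1 k)//= /upd eqxx -mulrA; congr (_ * _); rewrite mulrC; congr (_ * _).
by apply: eq_bigr => l /negbTE ->.
Qed.

End tensor_sum.

(** * Hat functions at integer nodes *)

Section hat.
Variable R : realType.
Implicit Types (i j : nat) (u : R).

Definition hat j u : R := Num.max 0 (1 - `|u - j%:R|).

Lemma hat_ge0 j u : 0 <= hat j u. Proof. by rewrite le_max lexx. Qed.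

Lemma hat_neq0 j u : hat j u != 0 -> `|u - j%:R| < 1.
Proof.
rewrite /hat; have [h|h] := leP 0 (1 - `|u - j%:R|).
  by move=> h'; rewrite -subr_gt0 lt_neqAle eq_sym h'.
by rewrite eqxx.
Qed.

Lemma hatE i j u : i%:R <= u <= i.+1%:R ->
  hat j u = (j == i)%:R * (i.+1%:R - u) + (j == i.+1)%:R * (u - i%:R).
Proof.
rewrite -[i.+1%:R]natr1 => /andP[iu ui]; rewrite /hat.
have [ji|ij|->] := ltngtP j i.
- have : (j.+1%:R : R) <= i%:R by rewrite ler_nat.
  rewrite -natr1 ltn_eqF ?(ltn_trans ji)// !mul0r addr0 => h.
  by rewrite ger0_norm ?max_l//; lra.
- have [->|ji] := eqVneq j i.+1.
    rewrite -natr1 mul0r mul1r add0r ler0_norm; last lra.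
    by rewrite max_r; lra.
  have : (i.+2%:R : R) <= j%:R by rewrite ler_nat ltn_neqAle eq_sym ji.
  rewrite -[i.+2%:R]natr1 -[i.+1%:R]natr1 !mul0r addr0 => h.
  by rewrite ler0_norm ?max_l//; lra.
- rewrite ltn_eqF// mul1r mul0r addr0 ger0_norm; last lra.
  by rewrite max_r; lra.
Qed.

Lemma hat_nat i j : hat j i%:R = (j == i)%:R.
Proof.
have -> := @hatE i j i%:R; last by rewrite lexx ler_nat leqnSn.
by rewrite subrr mulr0 addr0 -natr1 addrAC subrr add0r mulr1.
Qed.

Lemma sum_hat (N : nat) u : 0 <= u <= N%:R -> \sum_(j < N.+1) hat j u = 1.
Proof.
move=> /andP[u0 uN].
have sum_delta k (c : R) : (k < N.+1)%N ->
    \sum_(j < N.+1) (j == k :> nat)%:R * c = c.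
  move=> kN; rewrite (bigD1 (Ordinal kN))//= eqxx mul1r big1 ?addr0// => j jk.
  by rewrite (_ : (j == k :> nat) = false) ?mul0r//; apply/negbTE.
(* The right endpoint is separate: its cell would be [[N, N+1]], whose right hat is not in the
   sum. *)
have [->|uN'] := eqVneq u N%:R.
  under eq_bigr do rewrite hat_nat -[_%:R]mulr1.
  exact: sum_delta.
pose i := Num.truncn u.
have /andP[iu ui] : i%:R <= u < i.+1%:R by exact: truncn_itv.
have iN : (i < N)%N.
  by rewrite -(ltr_nat R) (le_lt_trans iu)// lt_neqAle uN'.
under eq_bigr do rewrite (@hatE i) ?iu ?ltW//.
rewrite big_split/= !sum_delta ?ltnS// 1?ltnW// -natr1; lra.
Qed.

End hat.

(** The variables are pushed to nodes one at a time. Within its cell a variable lies between two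
    positions where [F] is nonnegative, and affinity makes [F u] a convex combination of the two
    values. *)
Lemma multiaffine_ge0 (R : realType) (n N : nat) (F : ('I_n -> R) -> R) :
  antisymmetric_fun F ->
  (forall t k (i : nat) a b r, i%:R <= a -> a <= r -> r <= b -> b <= i.+1%:R ->
    (b - a) * F (upd t k r) =
    (b - r) * F (upd t k a) + (r - a) * F (upd t k b)) ->
  (forall J : 'I_n -> nat, (forall i j : 'I_n, i <= j -> J i <= J j)%N ->
    (forall i, J i <= N)%N -> 0 <= F (fun l => (J l)%:R)) ->
  forall u : 'I_n -> R, (forall i j : 'I_n, (i <= j)%N -> u i <= u j) ->
    (forall i, 0 <= u i <= N%:R) -> 0 <= F u.
Proof.
move=> asF affF nodeF u0 u0_sorted u0_itv.
(* Variables of index at least [k] already sit at nodes: vacuous for [k = n], while [k = 0] is the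
   hypothesis on nodes. *)
suff key k : forall u : 'I_n -> R,
    (forall i j : 'I_n, (i <= j)%N -> u i <= u j) ->
    (forall i, 0 <= u i <= N%:R) ->
    (forall l : 'I_n, (k <= l)%N -> exists i : nat, u l = i%:R) -> 0 <= F u.
  by apply: (key n) => // l; rewrite leqNgt ltn_ord.
elim: k => [|k IH] u u_sorted u_itv u_node.
  have uE l : u l = (Num.truncn (u l))%:R.
    by have [i ->] := u_node l (leq0n l); rewrite natrK.
  have -> : u = fun l => (Num.truncn (u l))%:R by apply/funext.
  apply: nodeF => [i j ij|i].
    by rewrite -(ler_nat R) -!uE u_sorted.
  by rewrite -(ler_nat R) -uE; case/andP: (u_itv i).
have [nk|kn] := leqP n k.
  by apply: IH => // l kl; have := ltn_ord l; rewrite ltnNge (leq_trans nk kl).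
pose o := Ordinal kn; pose i := Num.truncn (u o).
have /andP[uo0 uoN] := u_itv o.
have /andP[iu ui] : i%:R <= u o < i.+1%:R by exact: truncn_itv.
have k_node : (exists i : nat, u o = i%:R) -> 0 <= F u.
  move=> uo; apply: IH => // l; rewrite leq_eqVlt => /predU1P[kl|/u_node//].
  by rewrite (_ : l = o)//; exact: val_inj.
have [uoi|iu'] := leP (u o) i%:R.
  by apply: k_node; exists i; apply/le_anti; rewrite uoi.
have iN : (i < N)%N by rewrite -(ltr_nat R) (lt_le_trans iu').
(* Moving variable [k] up within the cell keeps the order, since the later ones are nodes above [i],
   hence at least [i.+1]. *)
have updP r : i%:R <= r -> r <= i.+1%:R -> (exists j : nat, r = j%:R) ->
    (forall l : 'I_n, (l < k)%N -> u l <= r) -> 0 <= F (upd u o r).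
  move=> ir ri r_node rP; have kP (l : 'I_n) : (k < l)%N -> i.+1%:R <= u l.
    move=> kl; have [j uj] := u_node l kl.
    rewrite uj ler_nat -(ltr_nat R) -uj (lt_le_trans iu')// u_sorted//.
    exact: ltnW.
  apply: IH => [l l' ll'|l|l kl]; rewrite /upd.
  - case: eqP => [lo|lo]; case: eqP => [lo'|lo'] //.
    + apply: (le_trans ri); apply: kP.
      by move: ll'; rewrite lo leq_eqVlt => /predU1P[/val_inj ol|//]; case: lo'.
    + apply: rP; move: ll'; rewrite lo' leq_eqVlt => /predU1P[/val_inj ol|//].
      by case: lo.
    + exact: u_sorted.
  - case: eqP => // _; rewrite (le_trans _ ir) ?ler0n//=.
    by rewrite (le_trans ri)// ler_nat.
  - case: eqP => [_|/eqP lo]; first exact: r_node.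
    by apply: u_node; rewrite ltn_neqAle kl andbT eq_sym.
have Fb : 0 <= F (upd u o (i.+1%:R)).
  apply: updP => //; first by rewrite ler_nat.
    by exists i.+1.
  by move=> l lk; rewrite (le_trans _ (ltW ui))// u_sorted//= ltnW.
(* The left position is an earlier variable lying strictly above [i], where [F] vanishes by
   coincidence; without one, it is the node [i] itself, and the order survives. *)
have [a [ia auo Fa]] : exists a, [/\ i%:R <= a, a <= u o &
    0 <= F (upd u o a)].
  have [[l [lk ul]]|noL] := pselect (exists l : 'I_n, (l < k)%N /\ i%:R < u l).
    exists (u l); split; [exact: ltW|by rewrite u_sorted//= ltnW|].
    rewrite (@antisymmetric_fun_eq0 _ _ F _ o l)//.
      by apply/eqP => ol; rewrite -ol ltnn in lk.
    by rewrite /upd eqxx ifN//; apply/eqP => ol; rewrite ol ltnn in lk.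
  exists i%:R; split => //; apply: updP => //; first by rewrite ler_nat.
    by exists i.
  by move=> l lk; rewrite leNgt; apply/negP => ul; apply: noL; exists l.
have := affF u o i a i.+1%:R (u o) ia auo (ltW ui) (lexx _).
rewrite upd_id => E.
have ba : 0 < i.+1%:R - a by rewrite subr_gt0 (le_lt_trans auo).
by rewrite -(pmulr_rge0 _ ba) E addr_ge0 ?mulr_ge0 ?subr_ge0 ?(ltW ui).
Qed.

(** * Propagation of positivity *)

(* Induction on the sum of integers k i >= t i - tau: replacing the largest
   variable r by r - 1 decreases it. *)
Lemma delay_flow_ge0 (R : realType) (n : nat) (tau eta : R)
    (alpha beta : R -> R) (F : ('I_n.+1 -> R) -> R) :
  L1loc alpha ->
  {ae lebesgue_measure, forall t : R,
     tau <= t <= tau + eta -> 0 <= (-1) ^+ n.+1 * beta t} ->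
  antisymmetric_fun F ->
  (forall t k c d, tau <= c -> abs_continuous c d (fun r => F (upd t k r))) ->
  (forall t k, {ae lebesgue_measure, forall r, tau <= r ->
    is_derive r (1 : R) (fun r => F (upd t k r))
      (- alpha r * F (upd t k r) - beta r * F (upd t k (r - 1)))}) ->
  (forall t, (forall i j : 'I_n.+1, (i <= j)%N -> t i <= t j) ->
    (forall i, tau - 1 <= t i <= tau) -> 0 <= F t) ->
  forall t, (forall i j : 'I_n.+1, (i <= j)%N -> t i <= t j) ->
    (forall i, tau - 1 <= t i <= tau + eta) ->
    (forall i j, t i - t j <= 1) -> 0 <= F t.
Proof.
move=> alphaL beta_sign asF acF dF F_base t0 t0_sorted t0_itv t0_spread.
suff key N : forall t (k : 'I_n.+1 -> nat), \sum_i k i = N ->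
    (forall i, t i <= tau + (k i)%:R) ->
    (forall i j : 'I_n.+1, (i <= j)%N -> t i <= t j) ->
    (forall i, tau - 1 <= t i <= tau + eta) ->
    (forall i j, t i - t j <= 1) -> 0 <= F t.
  apply: (key _ _ (fun i => (Num.truncn `|t0 i - tau|).+1) erefl) => // i.
  rewrite -lerBlDl (le_trans (ler_norm _))// ltW//.
  by have /andP[] := truncn_itv (normr_ge0 (t0 i - tau)).
elim: N => [|N IH] t k sum_k tk t_sorted t_itv t_spread.
  apply: F_base => // i; have /andP[-> _] := t_itv i.
  have : (k i <= 0)%N by rewrite -sum_k (bigD1 i)//= leq_addr.
  by rewrite leqn0 => /eqP ki; have := tk i; rewrite ki addr0.
have [tmax|taut] := leP (t ord_max) tau.
  apply: F_base => // i; have /andP[-> _] := t_itv i.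
  by rewrite (le_trans _ tmax)// t_sorted// leq_ord.
have kmax : (0 < k ord_max)%N.
  by rewrite lt0n; apply/eqP => k0; have := tk ord_max; rewrite k0; lra.
pose z r := F (upd t ord_max r).
have ordP (l : 'I_n.+1) : l != ord_max -> (l <= n.-1)%N.
  move=> lmax; have := ltn_ord l; rewrite ltnS leq_eqVlt => /predU1P[ln|].
    by case/eqP: lmax; exact: val_inj.
  by move=> ln; lia.
(* The starting time: [tau] if all other variables are at most [tau], where the base case applies;
   otherwise the second largest variable, where two arguments coincide and [z] vanishes. *)
have [c [tauc ct tc zc]] : exists c, [/\ tau <= c, c <= t ord_max,
    forall l, l != ord_max -> t l <= c & 0 <= z c].
  have [oth|[l lmax tl]] : (forall l, l != ord_max -> t l <= tau) \/
      exists2 l, l != ord_max & tau < t l.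
    have [?|/existsNP[l /not_implyP[lm /negP]]] :=
      pselect (forall l, l != ord_max -> t l <= tau); [by left|].
    by rewrite -ltNge => ?; right; exists l.
  - exists tau; split => //; first exact: ltW.
    apply: F_base => [i j ij|i]; rewrite /upd.
      case: eqP => [im|/eqP im]; case: eqP => [jm|/eqP jm] //.
      + case/eqP: jm; apply/val_inj/eqP; rewrite eqn_leq/= -ltnS ltn_ord/=.
        by rewrite im in ij.
      + exact: oth.
      + exact: t_sorted.
    case: eqP => [_|/eqP im]; first by rewrite lexx andbT; lra.
    by rewrite oth// andbT; case/andP: (t_itv i).
  (* Index [n.-1] is the one before [ord_max]; another variable exists here, so [n] is positive and
     the two indices differ. *)
  - have nn : (n.-1 < n.+1)%N by lia.
    have n0 : (0 < n)%N.
      have := ltn_ord l; rewrite lt0n; apply: contra_ltnN => /eqP n0.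
      case/eqP: lmax; apply: val_inj => /=; have := ltn_ord l; lia.
    exists (t (Ordinal nn)); split.
    + by rewrite (le_trans (ltW tl))// t_sorted//= ordP.
    + by rewrite t_sorted//=; lia.
    + by move=> j jm; rewrite t_sorted//= ordP.
    + have pm : Ordinal nn != ord_max by apply/eqP => /(congr1 val)/=; lia.
      rewrite /z (@antisymmetric_fun_eq0 _ _ F _ (Ordinal nn) ord_max)//=.
      by rewrite /upd (negbTE pm) eqxx.
rewrite -[t](upd_id _ ord_max) -/(z _).
apply: (@linear_ode_ge0 _ alpha (fun r => - (beta r * z (r - 1))) z c) => //.
- exact: acF.
- have := dF t ord_max; apply: filterS.
    exact: (ae_filter_ringOfSetsType lebesgue_measure).
  by move=> r h /andP[cr _]; apply: h; exact: le_trans cr.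
move: beta_sign; apply: filterS.
  exact: (ae_filter_ringOfSetsType lebesgue_measure).
move=> r beta_r /andP[cr rt].
have taur : tau <= r by exact: le_trans cr.
have {}beta_r : 0 <= (-1) ^+ n.+1 * beta r.
  apply: beta_r; rewrite taur (le_trans rt)//.
  by case/andP: (t_itv ord_max).
(* A cycle of length [n.+1], hence of sign [(-1) ^+ n]; [w] lists [r - 1] first and then the other
   variables in their order. *)
pose s : 'S_n.+1 := lift_perm ord0 ord_max 1%g.
pose w := upd t ord_max (r - 1) \o s.
have w0 : w ord0 = r - 1 by rewrite /w /= /upd lift_perm_id eqxx.
have wl l : w (lift ord0 l) = t (lift ord_max l).
  by rewrite /w /= /upd lift_perm_lift perm1 eq_sym (negbTE (neq_lift _ _)).
(* The spread of at most 1 is what makes [r - 1] the least argument, so [w] is sorted. *)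
have rt1 l : r - 1 <= t l by have := t_spread ord_max l; lra.
have lmax l : lift ord_max l != ord_max :> 'I_n.+1 by rewrite eq_sym neq_lift.
(* The delayed variable needs one unit less, so the new counts sum to [N]. *)
pose k' := (fun l => if l == ord_max then (k ord_max).-1 else k l) \o s.
have k'0 : k' ord0 = (k ord_max).-1 by rewrite /k' /= lift_perm_id eqxx.
have k'l l : k' (lift ord0 l) = k (lift ord_max l).
  by rewrite /k' /= lift_perm_lift perm1 (negbTE (lmax l)).
have Fw : 0 <= F w.
  apply: (IH w k') => [|i|i j ij|i|i j].
  - rewrite (bigD1_ord ord0)//= k'0; move: sum_k; rewrite (bigD1_ord ord_max)//=.
    under [in X in _ -> X]eq_bigr do rewrite k'l.
    by move=> h; lia.
  - case: (unliftP ord0 i) => [l|] ->; first by rewrite wl k'l.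
    have := tk ord_max; rewrite w0 k'0 -{1}(prednK kmax) -natr1; lra.
  - case: (unliftP ord0 i) ij => [l ->|->]; case: (unliftP ord0 j) => [l' ->|->] //.
    + by rewrite !wl => ll; apply: t_sorted; move: ll; rewrite /= /bump; lia.
    + by rewrite w0 wl.
  - case: (unliftP ord0 i) => [l|] ->; first by rewrite wl.
    rewrite w0; have /andP[_ ?] := t_itv ord_max; lra.
  - case: (unliftP ord0 i) => [l ->|->]; case: (unliftP ord0 j) => [l' ->|->].
    + by rewrite !wl.
    + by rewrite wl w0; have := tc _ (lmax l); lra.
    + by rewrite w0 wl; have := rt1 (lift ord_max l'); lra.
    + by rewrite subrr.
have Fwz : F w = (-1) ^+ n * z (r - 1).
  by rewrite asF odd_lift_perm odd_perm1 addbF /= signr_odd.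
(* The sign of the cycle and that of the hypothesis on [beta] multiply to -1. *)
suff -> : - (beta r * z (r - 1)) = (-1) ^+ n.+1 * beta r * F w.
  by rewrite mulr_ge0.
have sq1 : (-1) ^+ n * (-1) ^+ n = 1 :> R.
  by rewrite -signr_odd -expr2 sqrr_sign.
rewrite Fwz exprS; move: ((-1) ^+ n) (z (r - 1)) sq1 => e y sq1.
by rewrite -[LHS]mul1r -[X in X * - _]sq1; ring.
Qed.

(** * Multilinear interpolation on the cube *)

Section interpolation.
Variables (R : realType) (m N : nat).
Local Notation M := (N.+1%:R : R).
Implicit Types (Phi : Xtensor R m) (theta : cube R m).

Lemma Icc_itv (x : Icc R) : (-1 : R) <= \val x <= 0.
Proof. by case: x => x /= /set_mem; rewrite /= in_itv. Qed.

Lemma Icc_exists (r : R) : -1 <= r <= 0 -> exists x : Icc R, \val x = r.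
Proof.
move=> r01; have rI : r \in `[-1, 0]%classic by rewrite inE/= in_itv.
by exists (exist _ r rI).
Qed.

Lemma grid_hat_continuous j :
  continuous (fun x : Icc R => hat j (M * (\val x + 1))).
Proof.
move=> x; apply: (@continuous_comp _ _ _ (\val : Icc R -> R)
    (fun r => hat j (M * (r + 1)))).
  exact: initial_continuous.
apply: (@continuous_max R R (fun=> 0) (fun r => 1 - `|M * (r + 1) - j%:R|)).
  exact: cvg_cst.
apply: cvgB; first exact: cvg_cst.
apply: cvg_norm; apply: cvgB; last exact: cvg_cst.
by apply: cvgMr; apply: cvgD; [exact: cvg_id|exact: cvg_cst].
Qed.

(** The grid has [N.+1] cells, never zero, and [N.+2] nodes; the map [x -> M * (x + 1)] sends the
    nodes to the integers from 0 to [N.+1]. *)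
Definition grid_hat (j : 'I_N.+2) : Xspace R := Cmk (@grid_hat_continuous j).

Definition grid_node (j : nat) : R := -1 + j%:R / M.

Lemma grid_node_itv (j : 'I_N.+2) : -1 <= grid_node j <= 0.
Proof.
rewrite /grid_node lerDl divr_ge0//= -lerBrDl sub0r opprK ler_pdivrMr ?ltr0n//.
by rewrite mul1r ler_nat -ltnS.
Qed.

Definition grid_Icc (j : 'I_N.+2) : Icc R :=
  exist _ (grid_node j) (mem_set (grid_node_itv j)).

Definition grid_point (J : {ffun 'I_m -> 'I_N.+2}) : cube R m :=
  fun l => grid_Icc (J l).

(** A finite combination of elementary tensors, so linearity and the formula on tensors give its
    image under the tensor power. *)
Definition interpolant Phi : Xtensor R m :=
  \sum_(J : {ffun 'I_m -> 'I_N.+2})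
    Phi (grid_point J) *: tensor (fun l => grid_hat (J l)).

Lemma sum_CspaceE (K : topologicalType) (cK : compact [set: K]) (I : finType)
    (f : I -> Cspace R cK) x : (\sum_i f i) x = \sum_i f i x.
Proof. by elim/big_ind2 : _ => // g a h b <- <-. Qed.

Lemma interpolantE Phi theta : interpolant Phi theta =
  tensor_sum (Phi \o grid_point) (fun j : 'I_N.+2 => @hat R j)
    (fun l => M * (\val (theta l) + 1)).
Proof. by rewrite [LHS]sum_CspaceE; apply: eq_bigr. Qed.

(** The interpolant is an average of values of [Phi] at grid points, and only points within one mesh
    width in every coordinate carry weight. *)
Lemma interpolant_dist Phi theta e :
  (forall theta', (forall l, `|\val (theta l) - \val (theta' l)| < M^-1) ->
    `|Phi theta - Phi theta'| <= e) ->
  `|Phi theta - interpolant Phi theta| <= e.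
Proof.
move=> Phie; rewrite interpolantE /tensor_sum.
pose w (J : {ffun 'I_m -> 'I_N.+2}) :=
  \prod_l hat (J l) (M * (\val (theta l) + 1)).
have w0 J : 0 <= w J by apply: prodr_ge0 => l _; exact: hat_ge0.
have w1 : \sum_J w J = 1.
  rewrite -(bigA_distr_bigA (fun l (j : 'I_N.+2) =>
    hat j (M * (\val (theta l) + 1)))) big1// => l _.
  apply: sum_hat; have := Icc_itv (theta l) => /andP[h1 h2].
  have M0 : 0 <= M by [].
  by rewrite mulr_ge0 ?ler_piMr//; lra.
have wE (a : R) : a = \sum_J w J * a by rewrite -mulr_suml w1 mul1r.
rewrite [X in `|X - _|]wE [leRHS]wE -sumrB.
apply: le_trans (ler_norm_sum _ _ _) _; apply: ler_sum => J _.
rewrite [X in _ - X]mulrC -/(w J) -mulrBr normrM.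
rewrite (ger0_norm (w0 J)).
have [->|wJ] := eqVneq (w J) 0; first by rewrite !mul0r.
rewrite ler_wpM2l//; apply: Phie => l.
move/prodf_neq0 : wJ => /(_ l isT) /hat_neq0.
have M0 : 0 < M by [].
have -> : M * (\val (theta l) + 1) - (J l)%:R =
    M * (\val (theta l) - grid_node (J l)).
  by rewrite /grid_node; field; exact: lt0r_neq0.
by rewrite normrM gtr0_norm// mulrC -ltr_pdivlMr// mul1r.
Qed.

End interpolation.

(** * Uniform continuity on the cube and convergence of the interpolants *)

Section cube_topology.
Variables (R : realType) (m : nat).
Implicit Types (Phi : Xtensor R m) (theta : cube R m).

Lemma cube_continuous_dist Phi theta e : 0 < e ->
  exists2 r : R, 0 < r & forall theta',
    (forall l, `|\val (theta l) - \val (theta' l)| < r) ->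
    `|Phi theta - Phi theta'| < e.
Proof.
move=> e0.
(* The filter of coordinatewise balls converges to [theta] in the product topology because each of
   its projections does. *)
pose G : set_system (cube R m) := filter_from [set r : R | 0 < r]
  (fun r => [set theta' | forall l, `|\val (theta l) - \val (theta' l)| < r]).
have FG : Filter G.
  apply: filter_from_filter; first by exists 1 => /=.
  move=> r s /= r0 s0; exists (Num.min r s); first by rewrite /= lt_min r0.
  by move=> th /= H; split => l; have := H l; rewrite lt_min => /andP[].
have G_cvg : G --> theta.
  apply/cvg_sup => l; apply/cvg_image.
    by apply/seteqP; split => // y _; exists (fun=> y).
  move=> B /nbhs_ballP[r/= r0 rB].
  exists ((fun th : cube R m => th l) @^-1` B).
    by exists r => // th /= H; apply: rB; exact: H.
  by apply/seteqP; split => [y [th Bth <-]//|y By]; exists (fun=> y).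
have /cvgrPdist_lt/(_ e e0) : Phi th @[th --> G] --> Phi theta.
  exact: cvg_trans (cvg_app _ G_cvg) (Cval_continuous Phi theta).
by move=> [r /= r0 rP]; exists r => // th /rP.
Qed.

(** Heine's theorem by compactness, with the mesh width of the grid as modulus. *)
Lemma cube_unif_continuous Phi e : 0 < e ->
  \forall N \near \oo, forall theta theta',
    (forall l, `|\val (theta l) - \val (theta' l)| < N.+1%:R^-1) ->
    `|Phi theta - Phi theta'| <= e.
Proof.
move=> e0; have e20 : 0 < e / 2 by rewrite divr_gt0.
have /compact_near_coveringP cK := @compact_cube R m.
have := cK nat \oo (fun N theta => forall theta',
    (forall l, `|\val (theta l) - \val (theta' l)| < N.+1%:R^-1) ->
    `|Phi theta - Phi theta'| <= e) _.
move=> H; suff : \forall N \near \oo, [set: cube R m] `<=` [set theta |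
    forall theta', (forall l, `|\val (theta l) - \val (theta' l)| < N.+1%:R^-1) ->
    `|Phi theta - Phi theta'| <= e].
  by apply: filterS => N NP theta; exact: NP.
apply: H => x _; have [r r0 rP] := cube_continuous_dist Phi x e20.
have r20 : 0 < r / 2 by rewrite divr_gt0.
(* Two radii of [r / 2] keep both [x'] and [theta'] within [r] of [x]. *)
exists ([set x' | forall l, `|\val (x l) - \val (x' l)| < r / 2],
        [set N | N.+1%:R^-1 < r / 2]) => /=.
  split; last exact: (near_infty_natSinv_lt (PosNum r20)).
  apply: (@filter_forall _ 'I_m (fun l (x' : cube R m) =>
    `|\val (x l) - \val (x' l)| < r / 2) (nbhs x)) => l.
  have /cvgrPdist_lt : \val (x' l) @[x' --> x] --> (\val (x l) : R).
    apply: (@continuous_comp _ _ _ (fun x' : cube R m => x' l)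
        (\val : Icc R -> R)).
      exact: (@proj_continuous 'I_m (fun=> Icc R) l).
    exact: initial_continuous.
  by apply.
move=> [x' N] /= [xx' Nr] theta' x'th.
have h1 : `|Phi x - Phi x'| < e / 2.
  by apply: rP => l; apply: lt_trans (xx' l) _; lra.
have h2 : `|Phi x - Phi theta'| < e / 2.
  apply: rP => l; have a1 := xx' l; have a2 := lt_trans (x'th l) Nr.
  have -> : \val (x l) - \val (theta' l) =
    (\val (x l) - \val (x' l)) + (\val (x' l) - \val (theta' l)) by ring.
  by apply: le_lt_trans (ler_normD _ _) _; lra.
have -> : Phi x' - Phi theta' = (Phi x - Phi theta') - (Phi x - Phi x') by ring.
by apply: le_trans (ler_normB _ _) _; lra.
Qed.

Lemma interpolant_cvg Phi : interpolant N Phi @[N --> \oo] --> Phi.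
Proof.
apply/cvgrPdist_le => e e0; have := cube_unif_continuous Phi e0.
apply: filterS => N NP; apply: Cnorm_le => [|theta]; first exact: ltW.
by apply: interpolant_dist => theta'; exact: NP.
Qed.

End cube_topology.

(** * The exterior power of the solution operator *)

Lemma is_derive_sum_scale (R : realType) n (c : 'I_n -> R) (x : 'I_n -> R -> R)
    (dx : 'I_n -> R) (t : R) :
  (forall j, is_derive t (1 : R) (x j) (dx j)) ->
  is_derive t (1 : R) (fun r => \sum_j c j * x j r) (\sum_j c j * dx j).
Proof.
move=> dxP; have -> : (fun r => \sum_j c j * x j r) = \sum_j (c j *: x j).
  by apply/funext => r; rewrite fct_sumE.
exact: is_derive_sum.
Qed.

Lemma interpolant_antisymmetric (R : realType) m N (Phi : Xtensor R m)
    (x : 'I_N.+2 -> R -> R) :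
  Xwedge R m Phi -> antisymmetric_fun (tensor_sum (Phi \o @grid_point R m N) x).
Proof.
move=> asPhi; apply: tensor_sum_antisymmetric => s J /=.
rewrite -asPhi; congr (Cval Phi _); apply/funext => l.
by rewrite /grid_point /= ffunE.
Qed.

(** At a sorted node only one summand survives, the value of [Phi] at a grid point of the simplex;
    [multiaffine_ge0] does the rest. *)
Lemma interpolant_ge0 (R : realType) m N (Phi : Xtensor R m) (u : 'I_m -> R) :
  Xwedge R m Phi -> (forall theta, simplex R m theta -> 0 <= Phi theta) ->
  (forall i j : 'I_m, (i <= j)%N -> u i <= u j) ->
  (forall i, 0 <= u i <= N.+1%:R) ->
  0 <= tensor_sum (Phi \o @grid_point R m N) (fun j : 'I_N.+2 => @hat R j) u.
Proof.
move=> asPhi Phi0; move: u; apply: multiaffine_ge0.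
- exact: interpolant_antisymmetric.
- move=> t k i a b r ia ar rb bi.
  have [c cE] := tensor_sum_upd (Phi \o @grid_point R m N)
    (fun j : 'I_N.+2 => @hat R j) t k.
  rewrite !cE !mulr_sumr -big_split; apply: eq_bigr => j _ /=.
  by rewrite !(@hatE _ i); [ring|apply/andP; split; lra..].
move=> J J_sorted JN.
have JN' l : (J l < N.+2)%N by rewrite ltnS.
pose J' : {ffun 'I_m -> 'I_N.+2} := [ffun l => Ordinal (JN' l)].
rewrite /tensor_sum (bigD1 J')//= [X in _ + X]big1 => [|K KJ].
  rewrite addr0 big1 => [|l _]; last by rewrite hat_nat ffunE/= eqxx.
  rewrite mulr1; apply: Phi0 => i j ij.
  rewrite /= /grid_node !ffunE/= lerD2l ler_pM2r ?invr_gt0// ler_nat.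
  exact: J_sorted.
have [l Kl] : exists l, K l != J' l.
  apply/existsP; rewrite -negb_forall; apply: contra KJ => /forallP KJ.
  by apply/eqP/ffunP => l; apply/eqP.
rewrite (bigD1 l)//= hat_nat (_ : (K l == J l :> nat) = false) ?mul0r ?mulr0//.
by apply/negbTE; move: Kl; rewrite ffunE.
Qed.

Lemma interpolant_flow_ge0 (R : realType) (n N : nat) (tau eta : R)
    (alpha beta : R -> R) (U : Xspace R -> Xspace R) (Phi : Xtensor R n.+1)
    (theta : cube R n.+1) :
  0 <= eta -> L1loc alpha ->
  {ae lebesgue_measure, forall t : R,
     tau <= t <= tau + eta -> 0 <= (-1) ^+ n.+1 * beta t} ->
  is_solution_operator alpha beta (tau + eta) tau U ->
  Xwedge R n.+1 Phi -> (forall th, simplex R n.+1 th -> 0 <= Phi th) ->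
  simplex R n.+1 theta ->
  0 <= \sum_(J : {ffun 'I_n.+1 -> 'I_N.+2})
    Phi (grid_point R J) * \prod_l U (grid_hat R (J l)) (theta l).
Proof.
move=> eta0 alphaL beta_sign HU asPhi Phi0 theta_sorted.
have /choice[x xP] : forall j : 'I_N.+2, exists x : R -> R,
    is_solution alpha beta tau (grid_hat R j) x /\
    forall th : Icc R, U (grid_hat R j) th = x (tau + eta + \val th).
  by move=> j; have [x xs xU] := HU (grid_hat R j); exists x.
pose F := tensor_sum (Phi \o @grid_point R n.+1 N) x.
have -> : \sum_(J : {ffun 'I_n.+1 -> 'I_N.+2})
    Phi (grid_point R J) * \prod_l U (grid_hat R (J l)) (theta l) =
    F (fun l => tau + eta + \val (theta l)).
  apply: eq_bigr => J _; congr (_ * _); apply: eq_bigr => l _.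
  by have [_ ->] := xP (J l).
have theta_itv l := Icc_itv (theta l).
apply: (@delay_flow_ge0 R n tau eta alpha beta F) => //.
- exact: interpolant_antisymmetric.
- move=> t k c d tauc.
  have [w wE] := tensor_sum_upd (Phi \o @grid_point R n.+1 N) x t k.
  have -> : (fun r => F (upd t k r)) = (fun r => \sum_j w j * x j r).
    by apply/funext => r; exact: wE.
  apply: abs_continuous_sum => j; have [[_ acx _ _] _] := xP j.
  (* A solution is absolutely continuous up to any [b >= tau], whereas [d] may lie before [tau]. *)
  apply: (@abs_continuous_sub _ tau (Num.max tau d)) => //.
    by rewrite le_max lexx orbT.
  by apply: acx; rewrite le_max lexx.
- move=> t k.
  have [w wE] := tensor_sum_upd (Phi \o @grid_point R n.+1 N) x t k.
  (* Finitely many exceptional null sets are merged into one. *)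
  have aex : {ae lebesgue_measure, forall (r : R) (j : 'I_N.+2), tau <= r ->
      is_derive r (1 : R) (x j) (- alpha r * x j r - beta r * x j (r - 1))}.
    by apply: filter_forall => j; have [[]] := xP j.
  move: aex; apply: filterS.
    exact: (ae_filter_ringOfSetsType lebesgue_measure).
  move=> r dx taur.
  have -> : (fun r => F (upd t k r)) = (fun r => \sum_j w j * x j r).
    by apply/funext => r'; exact: wE.
  apply: is_derive_eq (is_derive_sum_scale w (fun j => dx j taur)) _.
  rewrite /F !wE !mulr_sumr -sumrB.
  by apply: eq_bigr => j _; ring.
- move=> t t_sorted t_itv.
  (* On [[tau - 1, tau]] each solution is its initial hat, in the coordinate that makes the nodes
     integers. *)
  have -> : F t = tensor_sum (Phi \o @grid_point R n.+1 N)
      (fun j : 'I_N.+2 => @hat R j) (fun l => N.+1%:R * (t l - tau + 1)).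
    apply: eq_bigr => J _; congr (_ * _); apply: eq_bigr => l _.
    have /Icc_exists[th thE] : -1 <= t l - tau <= 0.
      by have := t_itv l => /andP[? ?]; apply/andP; split; lra.
    have [[_ _ _ xtau] _] := xP (J l); have := xtau th.
    have -> : tau + \val th = t l by rewrite thE; ring.
    by move=> ->; rewrite -thE.
  apply: interpolant_ge0 => // [i j ij|i].
    by rewrite ler_pM2l// lerD2r lerD2r t_sorted.
  have /andP[? ?] := t_itv i; rewrite mulr_ge0 ?ler_piMr//; lra.
- by move=> i j ij; rewrite lerD2l theta_sorted.
- by move=> i; have /andP[? ?] := theta_itv i; apply/andP; split; lra.
- move=> i j; have /andP[? ?] := theta_itv i.
  by have /andP[? ?] := theta_itv j; lra.
Qed.

Theorem theorem4p1 (R : realType) (m : nat) (m_ge1 : (1 <= m)%N)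
    (tau eta : R) (eta_ge0 : 0 <= eta)
    (alpha beta : R -> R) (alphaL : L1loc alpha) (betaL : L1loc beta)
    (beta_sign : {ae lebesgue_measure, forall t : R,
       tau <= t <= tau + eta -> 0 <= (-1) ^+ m * beta t})
    (U : Xspace R -> Xspace R)
    (HU : is_solution_operator alpha beta (tau + eta) tau U)
    (W : Xwedge R m -> Xwedge R m) (HW : is_exterior_power U W) :
  W @` Kcone R m `<=` Kcone R m.
Proof.
case: m m_ge1 beta_sign W HW => // n _ beta_sign W [T [Tcont Tten] WT].
move=> _ [phi phiK <-] theta theta_sorted; rewrite WT.
set Phi := \val phi; have asPhi : Xwedge R n.+1 Phi by exact: set_mem (valP phi).
have TN N : 0 <= T (interpolant N Phi) theta.
  rewrite /interpolant linear_sum sum_CspaceE.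
  under eq_bigr do rewrite linearZZ Tten.
  exact: (interpolant_flow_ge0 N eta_ge0 alphaL beta_sign HU asPhi phiK).
have Tcvg : T (interpolant N Phi) @[N --> \oo] --> T Phi.
  exact: cvg_comp (@interpolant_cvg R n.+1 Phi) (Tcont Phi).
(* Were the limit negative at [theta], its sup distance to every nonnegative approximant would be at
   least [- T Phi theta]. *)
rewrite leNgt; apply/negP => Tneg.
have e0 : 0 < - T Phi theta by rewrite oppr_gt0.
have /cvgrPdist_lt/(_ _ e0)[N _ /(_ N (leqnn N))/=] := Tcvg.
apply/negP; rewrite -leNgt.
apply: le_trans (le_Cnorm (T Phi - T (interpolant N Phi)) theta).
apply: (@le_trans _ _ (- (T Phi theta - T (interpolant N Phi) theta))).
  by rewrite opprB lerDr.
by rewrite -[leRHS]normrN; exact: ler_norm.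
Qed.
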